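(* Let $S,I:\mathbb{R}\to\mathbb{R}$ be $2\pi$-periodic Lipschitz functions and suppose there are $\alpha_0\in(0,\pi)$, $p,q\ge1$, $c_1,c_2>0$, $c_3\in(0,1]$ with $S(\theta)\le-c_1(\pi-\theta)^p$ for $\theta\in[\alpha_0,\pi]$, $S(\theta)\ge c_1(\theta+\pi)^p$ for $\theta\in[-\pi,-\alpha_0]$, $0\le I(\theta)\le c_2(\pi-|\theta|)^q$ for $\theta\in[-\pi,\pi]$, and $\min_{|\phi|\le\max\{|\theta|,\alpha_0\}}I(\phi)\ge c_3I(\theta)$ for $\theta\in[-\pi,\pi]$. Let $\omega_1,\dots,\omega_N\in\mathbb{R}$, $\|\Omega\|_\infty=\max_i|\omega_i|$, and for initial data $(\theta_i^0)$ let $(\theta_i(t))$ solve $\dot\theta_i=\omega_i+\frac{\kappa}{N}\sum_{j=1}^NI(\theta_j)S(\theta_i)$, $\theta_i(0)=\theta_i^0$, with $R(t)=\frac1N\sum_jI(\theta_j(t))$. Let $\mu$ be a probability measure on $[-\pi,\pi]$ with $R^*:=\int_{-\pi}^\pi I\,d\mu>0$, and assume \[ \kappa>\max\left\{\frac{4(4c_2)^{p/q}}{c_1c_3}\cdot\frac{\|\Omega\|_\infty}{(R^* )^{1+p/q}},\ \frac{4}{c_1c_3(\pi-\alpha_0)^p}\cdot\frac{\|\Omega\|_\infty}{R^*}\right\}. \] Then, with $\mu^{\otimes N}$ the product measure on $[-\pi,\pi]^N$, \[ \mu^{\otimes N}\Big\{(\theta_i^0)\in[-\pi,\pi]^N: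 R(t)>\tfrac{c_3R^*}{4}\ \forall t\ge0,\ \sup_{t\ge0}\theta_i(t)-\inf_{t\ge0}\theta_i(t)<2\pi\ \forall i\Big\}\ge1-\exp\left(-\frac{(R^* )^2N}{2\|I\|_{\sup}^2}\right). \]
   Context: $\|I\|_{\sup}=\sup_\theta|I(\theta)|$. *)

(* Defs.v *)
From HB Require Import structures.
From mathcomp Require Import all_boot all_order all_algebra.
From mathcomp Require Import all_classical all_reals all_analysis.

Import Order.TTheory GRing.Theory Num.Theory.
Import numFieldNormedType.Exports.
Local Open Scope classical_set_scope.
Local Open Scope ring_scope.

Definition periodic_2pi (R : realType) (f : R -> R) : Prop :=
  forall x, f (x + 2 * pi) = f x.

Definition lipschitz_fun (R : realType) (f : R -> R) : Prop :=
  exists L : R, forall x y, `|f x - f y| <= L * `|x - y|.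

Definition boxes (R : realType) (N : nat) : set (set ('I_N -> R)) :=
  [set B | exists A : 'I_N -> set R,
      (forall i, measurable (A i)) /\ B = [set x | forall i, A i (x i)]].

Definition RN (R : realType) (N : nat) := g_sigma_algebraType (boxes R N).

(* P is the N-fold product measure mu^{(x)N}: it agrees with the product of
   mu on boxes (this determines it uniquely on the product sigma-algebra). *)
Definition is_product_measure (R : realType) (N : nat)
    (mu : probability R R) (P : probability (RN R N) R) : Prop :=
  forall A : 'I_N -> set R, (forall i, measurable (A i)) ->
    P ([set x | forall i, A i (x i)] : set (RN R N)) =
      (\prod_(i < N) fine (mu (A i)))%:E.

Definition is_flow (R : realType) (N : nat) (S I : R -> R) (omega : 'I_N -> R)
    (kappa : R) (theta : ('I_N -> R) -> R -> 'I_N -> R) : Prop :=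
  forall x0 : 'I_N -> R,
    theta x0 0 = x0 /\
    forall (t : R) (i : 'I_N),
      is_derive t 1 (fun s => theta x0 s i)
        (omega i + kappa / N%:R * (\sum_(j < N) I (theta x0 t j)) * S (theta x0 t i)).

Definition order_param (R : realType) (N : nat) (I : R -> R) (th : 'I_N -> R) : R :=
  N%:R^-1 * \sum_(j < N) I (th j).

Definition sup_norm (R : realType) (I : R -> R) : R := sup (range (fun x => `|I x|)).

Definition max_norm (R : realType) (N : nat) (omega : 'I_N -> R) : R :=
  \big[Num.max/0]_(i < N) `|omega i|.

(* Main.v *)
(** Deterministic part: suppose the initial order parameter exceeds R*/2. An
    oscillator with I(theta_j(0)) > R*/4 cannot cross the barrier
    |theta| = max(|theta_j(0)|, alpha0) as long as R(t) >= c3 R*/4, because the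
    bound on kappa makes the drift point inwards there; on that region
    I(theta_j(t)) >= c3 I(theta_j(0)), and summing
    c3 I(theta_j(0)) - c3 R*/4 <= I(theta_j(t)) over all j keeps R(t) strictly
    above c3 R*/4, so the first time of equality never comes. With R(t) bounded
    below, points at distance delta from odd multiples of pi repel, for all
    delta in some [d1, d2]; this traps each trajectory in a window of length
    less than 2 pi.
    Probabilistic part: R(0) <= R*/2 is a lower tail event for a mean of
    independent variables with values in [0, sup I], so Hoeffding's inequality
    applies; it is obtained by discretising the values of I, which only uses
    the product measure on boxes. Measurability of the event follows from the
    continuity of the flow in the initial data (Gronwall). *)

Require Import Defs.
From HB Require Import structures.
From mathcomp Require Import all_boot all_order all_algebra.
From mathcomp Require Import all_classical all_reals all_analysis.
From mathcomp Require Import measurable_realfun ring lra.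
Import Order.TTheory GRing.Theory Num.Theory.
Import numFieldNormedType.Exports.
Local Open Scope classical_set_scope.
Local Open Scope ring_scope.
Set Implicit Arguments.
Unset Strict Implicit.
Unset Printing Implicit Defensive.

(** * Barriers for scalar trajectories *)

Lemma derive_lt0_right (R : realType) (f : R -> R) (x d : R) :
  is_derive x 1 f d -> d < 0 ->
  exists2 e : R, 0 < e & forall h, 0 < h < e -> f (x + h) < f x.
Proof.
move=> [fx <-] d0.
have /cvgr_lt/(_ _ d0) : h^-1 *: ((f \o shift x) (h *: 1) - f x)
    @[h --> 0^'] --> 'D_1 f x by exact: fx.
rewrite /dnbhs near_withinE => /nbhs_ballP[e /= e0 H].
exists e => // h /andP[h0 he].
have := H h; rewrite /ball /= sub0r normrN gtr0_norm // => /(_ he).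
rewrite gt_eqF // => /(_ isT).
rewrite [_ *: 1](_ : _ = h); last by rewrite /GRing.scale /= mulr1.
by rewrite /GRing.scale /= pmulr_rlt0 ?invr_gt0// subr_lt0 addrC.
Qed.

(** Take [tau] as the supremum of the times in [[a, t1]] with [f <= b]: beyond it [f] exceeds [b],
    and continuity forces equality at [tau]. *)
Lemma last_crossing (R : realType) (f : R -> R) (a b t1 : R) :
  continuous f -> a <= t1 -> f a <= b -> b < f t1 ->
  exists tau, [/\ a <= tau, tau < t1, f tau = b &
    forall t, tau < t <= t1 -> b < f t].
Proof.
move=> cf at1 fab bft1.
pose A := [set t | a <= t <= t1 /\ f t <= b].
have Aa : A a by split=> //; rewrite lexx.
have ubA : ubound A t1 by move=> t [/andP[]].
have supA : has_sup A by split; [exists a | exists t1].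
have out t : sup A < t <= t1 -> b < f t.
  move=> /andP[st tt1]; rewrite ltNge; apply/negP => ftb.
  have : A t by split=> //; rewrite tt1 (le_trans _ (ltW st))// ub_le_sup//; case: supA.
  by move/(ub_le_sup supA.2); rewrite leNgt st.
have asup : a <= sup A by apply: ub_le_sup => //; case: supA.
have supt1 : sup A <= t1 by apply: ge_sup => //; exists a.
have fle : f (sup A) <= b.
  rewrite leNgt; apply/negP => bf.
  have /cvgr_gt/(_ _ bf)/nbhs_ballP[e /= e0 H] := cf (sup A).
  have [t At ts] := sup_adherent e0 supA.
  have : b < f t.
    apply: H; rewrite /ball /= ger0_norm ?subr_ge0 ?ub_le_sup//; last by case: supA.
    by rewrite ltrBlDr addrC -ltrBlDr.
  by rewrite ltNge; case: At => _ ->.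
have slt : sup A < t1.
  by rewrite lt_neqAle supt1 andbT; apply/eqP => E; move: fle; rewrite E leNgt bft1.
exists (sup A); split=> //; apply/eqP; rewrite eq_le fle /= leNgt; apply/negP => fb.
have /cvgr_lt/(_ _ fb)/nbhs_ballP[e /= e0 H] := cf (sup A).
(* Were [f] below [b] at the supremum, it would still be below after a step [h]; the minimum keeps
   this step inside the continuity radius and not beyond [t1]. *)
pose h := Num.min (e / 2) (t1 - sup A).
have h0 : 0 < h by rewrite lt_min divr_gt0// subr_gt0.
have := out (sup A + h); rewrite ltrDl h0 /= -lerBrDl ge_min lexx orbT => /(_ isT).
rewrite ltNge ltW //; apply: H; rewrite /ball /= opprD addrA subrr sub0r normrN.
by rewrite gtr0_norm// gt_min; apply/orP; left; rewrite ltr_pdivrMr// mulr_natr mulr2n ltrDl.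
Qed.

(** Time reversal of [last_crossing], applied on [[- t1, 0]]. *)
Lemma first_crossing (R : realType) (f : R -> R) (b t1 : R) :
  continuous f -> 0 <= t1 -> b < f 0 -> f t1 <= b ->
  exists tau, [/\ 0 <= tau, tau <= t1, f tau = b &
    forall t, 0 <= t < tau -> b < f t].
Proof.
move=> cf t10 bf0 ft1.
have cg : continuous (f \o -%R).
  by move=> x; apply: continuous_comp; [exact: opp_continuous|exact: cf].
have [||//|tau [h1 h2 h3 h4]] := @last_crossing _ _ (- t1) b 0 cg.
- by rewrite oppr_le0.
- by rewrite /= opprK.
- by rewrite /= oppr0.
exists (- tau); split=> //; first by rewrite oppr_ge0 ltW.
  by rewrite lerNl.
move=> t /andP[t0 tt]; have := h4 (- t); rewrite /= opprK; apply.
by rewrite oppr_le0 t0 andbT ltrNr.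
Qed.

Lemma is_derive1_continuous (R : realType) (f df : R -> R) :
  (forall t : R, is_derive t 1 f (df t)) -> continuous f.
Proof. by move=> H t; apply: differentiable_continuous; apply/derivable1_diffP; case: (H t). Qed.

(** Just after the last contact preceding an excess, [f] should lie above [b]; the negative
    derivative at that contact makes it drop below instead. *)
Lemma barrier_above (R : realType) (f df : R -> R) (a b T : R) :
  (forall t : R, is_derive t 1 f (df t)) -> f a <= b ->
  (forall t, a <= t < T -> f t = b -> df t < 0) ->
  forall t, a <= t <= T -> f t <= b.
Proof.
move=> H fa Hb t /andP[at0 tT]; rewrite leNgt; apply/negP => bft.
have [tau [h1 h2 h3 h4]] := last_crossing (is_derive1_continuous H) at0 fa bft.
have d0 : df tau < 0 by apply: Hb => //; rewrite h1 (lt_le_trans h2).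
have [e e0 He] := derive_lt0_right (H tau) d0.
pose h := Num.min (e / 2) (t - tau).
have h0 : 0 < h by rewrite lt_min divr_gt0// subr_gt0.
have hht : h <= t - tau by rewrite ge_min lexx orbT.
have : b < f (tau + h) by apply: h4; rewrite ltrDl h0 /= -lerBrDl.
rewrite -h3 ltNge ltW// He// h0 gt_min; apply/orP; left.
by rewrite ltr_pdivrMr// mulr_natr mulr2n ltrDl.
Qed.

Lemma barrier_below (R : realType) (f df : R -> R) (a b T : R) :
  (forall t : R, is_derive t 1 f (df t)) -> b <= f a ->
  (forall t, a <= t < T -> f t = b -> 0 < df t) ->
  forall t, a <= t <= T -> b <= f t.
Proof.
move=> H fa Hb t tT; rewrite -lerN2.
apply: (@barrier_above _ (fun x => - f x) (fun x => - df x) a (- b) T _ _ _ t) => //.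
- by rewrite lerN2.
- by move=> s sT /oppr_inj fs; rewrite oppr_lt0; exact: Hb sT fs.
Qed.

Lemma barrier_confine (R : realType) (f df : R -> R) (b T : R) :
  (forall t : R, is_derive t 1 f (df t)) -> `|f 0| <= b ->
  (forall t, 0 <= t < T -> f t = b -> df t < 0) ->
  (forall t, 0 <= t < T -> f t = - b -> 0 < df t) ->
  forall t, 0 <= t <= T -> `|f t| <= b.
Proof.
move=> H; rewrite ler_norml => /andP[f1 f2] H1 H2 t tT; rewrite ler_norml.
by rewrite (barrier_below H f1 H2 tT) (barrier_above H f2 H1 tT).
Qed.

(** * Width of a trajectory repelled from the odd multiples of pi *)

Section Width.
Variables (R : realType) (f df : R -> R) (d1 d2 : R).
Hypothesis d12 : 0 < d1 < d2.
Hypothesis d2pi : d2 < pi.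
Hypothesis f_derive : forall t : R, is_derive t 1 f (df t).

Let at_centre (m : int) : R := (2 * m%:~R + 1) * pi.

(** Both radii act as barriers; for a trajectory starting near pi, the gap [d2 - d1] is what the
    width falls short of [2 * pi]. *)
Hypothesis repelled : forall (t d : R) (m : int), 0 <= t -> d1 <= d <= d2 ->
  (f t = at_centre m - d -> df t < 0) /\ (f t = at_centre m + d -> 0 < df t).

Let stay_below (m : int) (d s t : R) : d1 <= d <= d2 -> 0 <= s <= t ->
  f s <= at_centre m - d -> f t <= at_centre m - d.
Proof.
move=> dd /andP[s0 st] fs.
apply: (barrier_above f_derive fs (T := t)); last by rewrite st lexx.
by move=> u /andP[su _]; apply: (repelled m (le_trans s0 su) dd).1.
Qed.

Let stay_above (m : int) (d s t : R) : d1 <= d <= d2 -> 0 <= s <= t ->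
  at_centre m + d <= f s -> at_centre m + d <= f t.
Proof.
move=> dd /andP[s0 st] fs.
apply: (barrier_below f_derive fs (T := t)); last by rewrite st lexx.
by move=> u /andP[su _]; apply: (repelled m (le_trans s0 su) dd).2.
Qed.

(* A trajectory starting near pi may leave the neighbourhood of pi on either
   side, but only once; it is then trapped between two consecutive centres, at
   distance at least d2 from the new one. *)
Lemma width_lt_2pi_right : 0 <= f 0 <= pi ->
  exists2 c, c < 2 * pi & forall s t : R, 0 <= s -> 0 <= t -> f s - f t <= c.
Proof.
move=> /andP[f00 f0pi].
have pi0 : 0 < (pi : R) := pi_gt0 R.
have /andP[d10 d12'] := d12; have d2pi' := d2pi.
have D1 : d1 <= d1 <= d2 by rewrite lexx ltW.
have D2 : d1 <= d2 <= d2 by rewrite lexx ltW.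
have Z0 : at_centre 0 = pi by rewrite /at_centre mulr0 add0r mul1r.
have Z1 : at_centre 1 = 3 * pi by rewrite /at_centre; ring.
have ZN : at_centre (-1) = - pi by rewrite /at_centre; ring.
(* A start outside the inner radius of pi is confined by the inner barriers at [- pi + d1] and
   [pi - d1]. *)
have [f0d|f0d] := leP (f 0) (pi - d1).
  exists (2 * pi - 2 * d1); first by lra.
  move=> s t s0 t0.
  have := @stay_below 0 d1 0 s D1; rewrite Z0 lexx s0 => /(_ isT f0d).
  have := @stay_above (-1) d1 0 t D1; rewrite ZN lexx t0.
  have -> : - pi + d1 <= f 0 by lra.
  by move=> /(_ isT isT) ? ?; lra.
exists (2 * pi - (d2 - d1)); first by lra.
(* If the trajectory never goes left of [pi - d1], the outer barrier before [3 * pi] bounds it from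
   above. *)
have [Hall|] := pselect (forall t : R, 0 <= t -> pi - d1 <= f t).
  move=> s t s0 t0.
  have := @stay_below 1 d2 0 s D2; rewrite Z1 lexx s0.
  have -> : f 0 <= 3 * pi - d2 by lra.
  by move=> /(_ isT isT) ?; have ? := Hall _ t0; lra.
move=> /existsNP[t1 /not_implyP[t10 /negP]]; rewrite -ltNge => ft1.
move=> s t s0 t0.
have := @stay_above (-1) d2 0 t D2; rewrite ZN lexx t0.
have -> : - pi + d2 <= f 0 by lra.
move=> /(_ isT isT) ft.
(* The trajectory is left of [pi - d1] at [t1]; being right of [pi + d1] at [s] is excluded by the
   inner barriers, whichever of the two times comes first. *)
suff : f s <= pi + d1 by lra.
rewrite leNgt; apply/negP => fs.
have [t1s|st1] := leP t1 s.
  have := @stay_below 0 d1 t1 s D1; rewrite Z0 t10 t1s (ltW ft1) => /(_ isT isT) ?; lra.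
have := @stay_above 0 d1 s t1 D1; rewrite Z0 s0 (ltW fs) (ltW st1) => /(_ isT isT) ?; lra.
Qed.

End Width.

(** A negative start reduces to the previous case by reflection, which exchanges the odd multiples
    of pi of index [m] and [- m - 1]. *)
Lemma width_lt_2pi (R : realType) (f df : R -> R) (d1 d2 : R) :
  0 < d1 < d2 -> d2 < pi ->
  (forall t : R, is_derive t 1 f (df t)) ->
  (forall (t d : R) (m : int), 0 <= t -> d1 <= d <= d2 ->
    (f t = (2 * m%:~R + 1) * pi - d -> df t < 0) /\
    (f t = (2 * m%:~R + 1) * pi + d -> 0 < df t)) ->
  `|f 0| <= pi ->
  exists2 c, c < 2 * pi & forall s t : R, 0 <= s -> 0 <= t -> f s - f t <= c.
Proof.
move=> d12 d2pi fd rep; rewrite ler_norml => /andP[f0l f0r].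
have [f00|f00] := leP 0 (f 0).
  by apply: (width_lt_2pi_right d12 d2pi fd rep); rewrite f00.
have [||c c2 H] := @width_lt_2pi_right _ (fun t => - f t) (fun t => - df t) d1 d2 d12 d2pi.
- move=> t d m t0 dd; have [r1 r2] := rep t d (- m - 1) t0 dd.
  have E : (2 * (- m - 1)%:~R + 1) * pi = - ((2 * m%:~R + 1) * pi) :> R.
    by rewrite rmorphB rmorphN /=; ring.
  rewrite E in r1 r2; split => ft.
    by rewrite oppr_lt0; apply: r2; lra.
  by rewrite oppr_gt0; apply: r1; lra.
- by rewrite oppr_ge0 (ltW f00) lerNl.
by exists c => // s t s0 t0; have := H t s t0 s0; lra.
Qed.

(** * Dependence of the flow on the initial data *)

Lemma is_derive_le0_nonincr (R : realType) (f df : R -> R) (a b : R) :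
  (forall t : R, is_derive t 1 f (df t)) -> a <= b ->
  (forall t, a <= t <= b -> df t <= 0) -> f b <= f a.
Proof.
move=> H ab dle.
have [|c cab E] := MVT_segment ab (fun x _ => H x).
  by apply: continuous_subspaceT => x; exact: (is_derive1_continuous H).
by rewrite -subr_le0 E mulr_le0_ge0 ?subr_ge0//; apply: dle; move: cab; rewrite in_itv.
Qed.

Lemma is_derive_sumr (R : realType) (n : nat) (h : 'I_n -> R -> R) (dh : 'I_n -> R) (t : R) :
  (forall i, is_derive t 1 (h i) (dh i)) ->
  is_derive t 1 (fun s => \sum_(i < n) h i s) (\sum_(i < n) dh i).
Proof.
move=> H; have -> : (fun s => \sum_(i < n) h i s) = \sum_(i < n) h i.
  by apply/funext => s; rewrite fct_sumE.
exact: is_derive_sum.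
Qed.

(** Squared differences are used because they are differentiable: their sum [D] satisfies
    [D' <= K * D] with [K = 2 * L * N], so [expR (- K * s) * D s] is nonincreasing. *)
Lemma gronwall_flow (R : realType) (N : nat) (V : ('I_N -> R) -> 'I_N -> R)
    (L : R) (x y : R -> 'I_N -> R) (t : R) :
  (forall u v i, `|V u i - V v i| <= L * \sum_(j < N) `|u j - v j|) ->
  (forall (s : R) i, is_derive s 1 (fun s => x s i) (V (x s) i)) ->
  (forall (s : R) i, is_derive s 1 (fun s => y s i) (V (y s) i)) ->
  0 <= L -> 0 <= t ->
  \sum_(i < N) (x t i - y t i) ^+ 2 <=
    expR (2 * L * N%:R * t) * \sum_(i < N) (x 0 i - y 0 i) ^+ 2.
Proof.
move=> VL xV yV L0 t0.
pose d s i := x s i - y s i.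
pose D s := \sum_(i < N) d s i ^+ 2.
pose dD s := \sum_(i < N) 2 * d s i * (V (x s) i - V (y s) i).
pose K := 2 * L * N%:R.
have dDE (s : R) : is_derive s 1 D (dD s).
  apply: is_derive_sumr => i.
  have dd : is_derive s 1 (fun s : R => d s i) (V (x s) i - V (y s) i).
    exact: is_deriveB.
  have := @is_deriveX _ _ (fun s => d s i) 2 s 1 _ dd.
  rewrite exprfctE /= => h. apply: is_derive_eq h _.

  by rewrite /GRing.scale /= expr1.
have dDle s : dD s <= K * D s.
  (* Each cross term obeys [2 * |d i| * |d j| <= d i ^+ 2 + d j ^+ 2], and the double sum of the
     right-hand sides is [2 * N * D]. *)
  have -> : K * D s = \sum_(i < N) L * \sum_(j < N) (d s i ^+ 2 + d s j ^+ 2).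
    rewrite -mulr_sumr; under eq_bigr do rewrite big_split /= sumr_const card_ord.
    rewrite big_split /= sumr_const card_ord sumrMnl -/(D s) -mulr_natl /K; ring.
  apply: ler_sum => i _.
  apply: le_trans (ler_norm _) _; rewrite !normrM (ger0_norm (ler0n _ 2)).
  apply: le_trans (_ : 2 * `|d s i| * (L * \sum_(j < N) `|d s j|) <= _).
    by apply: ler_wpM2l; [rewrite mulr_ge0|exact: VL].
  rewrite mulrCA; apply: ler_wpM2l => //; rewrite mulr_sumr; apply: ler_sum => j _.
  rewrite -(real_normK (num_real (d s i))) -(real_normK (num_real (d s j))).
  by have := sqr_ge0 (`|d s i| - `|d s j|); rewrite !expr2; lra.
pose G s := expR (- K * s) * D s.
have GE (s : R) : is_derive s 1 G (expR (- K * s) * (dD s - K * D s)).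
  have e1 : is_derive s 1 (fun s : R => - K * s) (- K).
    by have := @is_deriveZ _ _ _ id (- K) s 1 1 (is_derive_id _ _); rewrite /GRing.scale /= mulr1.
  have e2 := @is_derive1_comp _ expR (fun s => - K * s) s _ _ (is_derive_expR _) e1.
  have e3 := is_deriveM e2 (dDE s).
  refine (is_derive_eq e3 _); rewrite /GRing.scale /=; ring.
have := @is_derive_le0_nonincr _ G _ 0 t GE t0.
have -> : G 0 = D 0 by rewrite /G mulr0 expR0 mul1r.
rewrite /G mulNr expRN => H.
have : D t <= expR (K * t) * D 0.
  rewrite -ler_pdivrMl ?expR_gt0//; apply: H => s _.
  by apply: mulr_ge0_le0; [exact: expR_ge0|rewrite subr_le0].
by [].
Qed.

Section Periodic.
Variable R : realType.
Implicit Type f : R -> R.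

Lemma periodic_2pi_int f (m : int) (x : R) :
  periodic_2pi R f -> f (x + 2 * pi * m%:~R) = f x.
Proof.
move=> fp; have nat_shift n y : f (y + 2 * pi * n%:R) = f y.
  elim: n y => [|n IH] y; first by rewrite mulr0 addr0.
  by rewrite -[RHS]IH -[RHS]fp -natr1; congr f; ring.
case: m => n; first exact: nat_shift.
by rewrite -[LHS](nat_shift n.+1) NegzE mulrNz mulrN -addrA addNr addr0.
Qed.

Lemma mod_2pi (x : R) : exists m : int, - pi <= x + 2 * pi * m%:~R <= pi.
Proof.
have pi0 : 0 < (pi : R) := pi_gt0 R.
exists (- Num.floor ((x + pi) / (2 * pi))).
have /andP[] := floor_itv ((x + pi) / (2 * pi)).
rewrite ler_pdivlMr ?mulr_gt0// ltr_pdivrMr ?mulr_gt0// intrD rmorphN /=.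
move: (_%:~R) => k; lra.
Qed.

Lemma periodic_lipschitz_bounded f :
  periodic_2pi R f -> lipschitz_fun R f -> exists M, forall x, `|f x| <= M.
Proof.
move=> fp [L fL]; have pi0 : 0 < (pi : R) := pi_gt0 R.
(* The constant in [lipschitz_fun] carries no sign, hence its absolute value; after reduction to
   [[- pi, pi]] the distance to 0 is at most pi. *)
exists (`|f 0| + `|L| * pi) => x.
have [m xm] := mod_2pi x; rewrite -(periodic_2pi_int m x fp).
set y := x + _ in xm *; rewrite -[f y](subrK (f 0)) addrC.
apply: le_trans (ler_normD _ _) _; rewrite lerD2l.
apply: le_trans (fL _ _) _; rewrite subr0.
apply: le_trans (ler_wpM2r (normr_ge0 _) (ler_norm L)) _.
by apply: ler_wpM2l => //; rewrite ler_norml.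
Qed.

Lemma lipschitz_continuous f : lipschitz_fun R f -> continuous f.
Proof.
move=> [L fL] x; apply/cvgrPdist_lt => e e0.
have L0 : 0 < `|L| + 1 by rewrite ltr_wpDl.
apply/nbhs_ballP; exists ((`|L| + 1)^-1 * e) => /=; first by rewrite mulr_gt0 ?invr_gt0.
move=> y; rewrite /ball /= ltr_pdivlMl// => xy.
apply: le_lt_trans (fL _ _) _; apply: le_lt_trans xy.
by apply: ler_wpM2r => //; rewrite (le_trans (ler_norm L))// lerDl.
Qed.

End Periodic.

(** A product of bounded Lipschitz factors is Lipschitz, and periodicity supplies the bounds. The
    sum of coordinate distances is the form that [gronwall_flow] expects. *)
Lemma meanfield_lipschitz (R : realType) (N : nat) (S I : R -> R)
    (omega : 'I_N -> R) (kappa : R) :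
  periodic_2pi R S -> periodic_2pi R I -> lipschitz_fun R S -> lipschitz_fun R I ->
  exists2 L, 0 <= L & forall (u v : 'I_N -> R) i,
    `|(omega i + kappa / N%:R * (\sum_(j < N) I (u j)) * S (u i))
      - (omega i + kappa / N%:R * (\sum_(j < N) I (v j)) * S (v i))|
      <= L * \sum_(j < N) `|u j - v j|.
Proof.
move=> Sp Ip SL IL.
have [MS SM] := periodic_lipschitz_bounded Sp SL.
have [MI IM] := periodic_lipschitz_bounded Ip IL.
have MS0 : 0 <= MS := le_trans (normr_ge0 _) (SM 0).
have MI0 : 0 <= MI := le_trans (normr_ge0 _) (IM 0).
case: SL IL => [LS SL] [LI IL].
exists (`|kappa / N%:R| * (`|LI| * MS + N%:R * MI * `|LS|)).
  by rewrite mulr_ge0// addr_ge0 ?mulr_ge0.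
move=> u v i; set D := \sum_(j < N) `|u j - v j|.
have E (a b c c' s s' : R) :
    (a + b * c * s) - (a + b * c' * s') = b * ((c - c') * s + c' * (s - s')).
  by ring.
rewrite E normrM -[leRHS]mulrA; apply: ler_wpM2l => //.
apply: le_trans (ler_normD _ _) _; rewrite [leRHS]mulrDl !normrM; apply: lerD.
  rewrite mulrAC; apply: ler_pM => //; rewrite -sumrB.
  apply: le_trans (ler_norm_sum _ _ _) _; rewrite mulr_sumr; apply: ler_sum => j _.
  apply: le_trans (IL _ _) _.
  by apply: ler_wpM2r => //; exact: ler_norm.
rewrite -[leRHS]mulrA; apply: ler_pM => //.
  apply: le_trans (ler_norm_sum _ _ _) _.
  apply: le_trans (ler_sum _ (fun j _ => IM (v j))) _.
  by rewrite sumr_const card_ord mulr_natl.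
apply: le_trans (SL _ _) _.
apply: le_trans (ler_wpM2r (normr_ge0 _) (ler_norm LS)) _.
by apply: ler_wpM2l => //; rewrite /D (bigD1 i)//= lerDl sumr_ge0.
Qed.

(** * Measurability on the product space *)

Lemma nat_inv_lt (R : realType) (e : R) : 0 < e -> exists m : nat, m.+1%:R^-1 < e.
Proof.
move=> e0; exists (Num.trunc e^-1); rewrite invf_plt ?posrE//.
have /truncn_itv/andP[] // : 0 <= e^-1 by rewrite invr_ge0 ltW.
Qed.

Lemma bigcap_countType_measurable (d : measure_display) (T : measurableType d)
    (U : countType) (F : U -> set T) :
  (forall u, measurable (F u)) -> measurable (\bigcap_u F u).
Proof.
move=> mF; rewrite -[X in measurable X]setCK setC_bigcap; apply: measurableC.
apply: countable_bigcupT_measurable => [|u]; first exact: countableP.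
exact: measurableC.
Qed.

Lemma box_measurable (R : realType) (N : nat) (A : 'I_N -> set R) :
  (forall i, measurable (A i)) ->
  measurable ([set x | forall i, A i (x i)] : set (RN R N)).
Proof. by move=> mA; apply: sub_sigma_algebra; exists A. Qed.

(** Continuity for the maximum distance, in epsilon-delta form so that it meets the boxes generating
    the sigma-algebra directly. *)
Definition box_continuous (R : realType) (N : nat) (g : ('I_N -> R) -> R) :=
  forall x e, 0 < e ->
    exists2 d, 0 < d & forall y, (forall i, `|x i - y i| < d) -> `|g x - g y| < e.

Section BoxContinuous.
Variables (R : realType) (N : nat).
Implicit Types g h : ('I_N -> R) -> R.

Lemma box_continuous_comp (f : R -> R) g :
  continuous f -> box_continuous g -> box_continuous (f \o g).
Proof.
move=> cf cg x e e0.
have /cvgrPdist_lt/(_ _ e0)/nbhs_ballP[d /= d0 fd] := cf (g x).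
by have [d' d'0 gd] := cg x d d0; exists d' => // y xy; apply: fd; exact: gd.
Qed.

Lemma box_continuousD g h :
  box_continuous g -> box_continuous h -> box_continuous (fun x => g x + h x).
Proof.
move=> cg ch x e e0; have e20 : 0 < e / 2 by rewrite divr_gt0.
have [d d0 gd] := cg x _ e20; have [d' d'0 hd] := ch x _ e20.
exists (Num.min d d'); first by rewrite lt_min d0.
move=> y xy; rewrite opprD addrACA; apply: le_lt_trans (ler_normD _ _) _.
by rewrite [e]splitr ltrD// ?gd ?hd// => i; have := xy i; rewrite lt_min => /andP[].
Qed.

Lemma box_continuousN g : box_continuous g -> box_continuous (fun x => - g x).
Proof.
move=> cg x e e0; have [d d0 gd] := cg x e e0; exists d => // y xy.
by rewrite -opprD normrN gd.
Qed.

Lemma box_continuous_sum (n : nat) (g : 'I_n -> ('I_N -> R) -> R) :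
  (forall i, box_continuous (g i)) ->
  box_continuous (fun x => \sum_(i < n) g i x).
Proof.
elim: n g => [|n IH] g cg.
  move=> x e e0; exists 1 => // y _.
  by rewrite !big_ord0 subrr normr0.
have E : (fun x => \sum_(i < n.+1) g i x) =
    (fun x => \sum_(i < n) g (widen_ord (leqnSn n) i) x + g ord_max x).
  by apply/funext => x; rewrite big_ord_recr.
by rewrite E; apply: box_continuousD => //; apply: IH => i; exact: cg.
Qed.

(** The set is open, hence the union of the countably many boxes with rational centre and radius
    [1 / (k + 1)] contained in it. *)
Lemma box_continuous_gt_measurable g (a : R) :
  box_continuous g -> measurable ([set x | a < g x] : set (RN R N)).
Proof.
move=> cg.
pose B (u : {ffun 'I_N -> rat} * nat) : set (RN R N) :=
  [set x | forall i, ball (ratr (u.1 i) : R) u.2.+1%:R^-1 (x i)].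
pose F u : set (RN R N) := if `[< B u `<=` [set x | a < g x] >] then B u else set0.
rewrite [X in measurable X](_ : _ = \bigcup_u F u).
  apply: countable_bigcupT_measurable => [|u]; [exact: countableP|rewrite /F].
  case: ifP => _ //; apply: (@box_measurable R N (fun i => ball (ratr (u.1 i) : R) u.2.+1%:R^-1)).
  by move=> i; rewrite ball_itv; exact: measurable_itv.
rewrite eqEsubset; split=> [x /= ax|x [u _]]; last first.
  by rewrite /F; case: asboolP => // uA /uA.
have [|d d0 gd] := cg x (g x - a); first by rewrite subr_gt0.
(* Half of [d], since two points of a box are compared through its centre. *)
have [|k kd] := @nat_inv_lt R (d / 2); first by rewrite divr_gt0.
have k0 : 0 < k.+1%:R^-1 :> R by rewrite invr_gt0.
have /choice[c cP] : forall i, exists q : rat, ball (ratr q : R) k.+1%:R^-1 (x i).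
  move=> i; have [|q] := @rat_in_itvoo R (x i - k.+1%:R^-1) (x i + k.+1%:R^-1).
    by rewrite ltrBlDr -addrA ltrDl addr_gt0.
  rewrite in_itv /= => /andP[q1 q2]; exists q.
  rewrite /ball /= ltr_norml; move: q1 q2; move: (k.+1%:R^-1) => r ? ?.
  by apply/andP; split; lra.
exists ([ffun i => c i], k) => //; rewrite /F; case: asboolP => [_ i|[]].
  by rewrite ffunE.
move=> y yB /=; have := gd y; rewrite ltr_norml => H.
suff /H/andP[_ ?] : forall i, `|x i - y i| < d by lra.
move=> i; have := yB i; have := cP i; rewrite /= ffunE /ball /= !ltr_norml.
move: (k.+1%:R^-1) kd => r ?; by move=> /andP[? ?] /andP[? ?]; apply/andP; split; lra.
Qed.

Lemma box_continuous_ge_measurable g (a : R) :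
  box_continuous g -> measurable ([set x | a <= g x] : set (RN R N)).
Proof.
move=> cg; rewrite (_ : [set x | _] = ~` [set x | - a < - g x]).
  by apply: measurableC; apply: box_continuous_gt_measurable; exact: box_continuousN.
by apply/seteqP; split=> x /=; rewrite ltrN2 leNgt => /negP.
Qed.

End BoxContinuous.

Lemma ge_on_rationals (R : realType) (h : R -> R) (c : R) :
  continuous h -> (forall q : rat, c <= h (ratr q)) -> forall u, c <= h u.
Proof.
move=> ch hq u; rewrite leNgt; apply/negP => hu.
have /cvgr_lt/(_ _ hu)/nbhs_ballP[e /= e0 H] := ch u.
have [|q] := @rat_in_itvoo R (u - e) (u + e).
  by rewrite ltrBlDr -addrA ltrDl addr_gt0.
rewrite in_itv /= => /andP[q1 q2].
have := hq q; rewrite leNgt => /negP; apply; apply: H.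
by rewrite /ball /= ltr_norml; apply/andP; split; lra.
Qed.

(** This map sends the line onto [[0, n]] when [n >= 0], so that a condition on all times of
    [[0, n]] can be tested at rational arguments. *)
Lemma clamp_continuous (R : realType) (n : R) : continuous (fun t : R => Num.min `|t| n).
Proof.
apply: lipschitz_continuous; exists 1 => x y; rewrite mul1r.
apply: le_trans (ler_dist_dist x y); rewrite ler_norml.
have := ler_norm (`|x| - `|y|); have := ler_norm (`|y| - `|x|); rewrite distrC => h1 h2.
by case: (leP `|x| n) => a; case: (leP `|y| n) => b; apply/andP; split; lra.
Qed.

(** * Measurability of conditions imposed at all times *)

Section TimeUniform.
Variables (R : realType) (N : nat) (h : ('I_N -> R) -> R -> R).
Hypothesis h_box : forall t, 0 <= t -> box_continuous (h^~ t).
Hypothesis h_cont : forall x, continuous (h x).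

(** A strict inequality does not pass from rational times to real ones. On each [[0, n]] the minimum
    is attained, which leaves a margin [1 / (m + 1)]; the resulting large inequality does pass. *)
Lemma measurable_forall_gt (r : R) :
  measurable ([set x | forall t, 0 <= t -> r < h x t] : set (RN R N)).
Proof.
pose c (n : nat) (t : R) := Num.min `|t| n%:R.
have c0 n t : 0 <= c n t by rewrite le_min normr_ge0 /=.
rewrite (_ : [set x | _] = \bigcap_(n : nat) \bigcup_(m : nat) \bigcap_(q : rat)
    [set x | r + m.+1%:R^-1 <= h x (c n (ratr q))]); last first.
  rewrite eqEsubset; split=> x /= H.
    move=> n _; have ch : {within `[0, n%:R], continuous (h x)}.
      exact: continuous_subspaceT.
    have [t tn tmin] := EVT_min (ler0n R n) ch.
    have [|m mP] := @nat_inv_lt R (h x t - r).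
      by rewrite subr_gt0 H//; move: tn; rewrite in_itv /= => /andP[].
    exists m => // q _ /=.
    apply: le_trans (tmin _ _); last by rewrite in_itv /= c0 /c ge_min lexx orbT.
    by rewrite -lerBrDl ltW.
  move=> t t0.
  (* This integer exceeds [t], so clamping leaves [t] unchanged. *)
  have [m _ mP] := H (Num.trunc t).+1 I.
  have ch : continuous (h x \o c (Num.trunc t).+1).
    by move=> u; apply: continuous_comp; [exact: clamp_continuous|exact: h_cont].
  have := ge_on_rationals ch (fun q => mP q I) t.
  rewrite /= /c ger0_norm// min_l; last by have /andP[_ /ltW] := truncn_itv t0.
  by apply: lt_le_trans; rewrite ltrDl invr_gt0.
apply: bigcapT_measurable => n; apply: bigcupT_measurable => m.
apply: bigcap_countType_measurable => q.
by apply: box_continuous_ge_measurable; exact: h_box.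
Qed.

End TimeUniform.

Lemma ereal_width_le (R : realType) (f : R -> R) (c : R) :
  (ereal_sup [set (f t)%:E | t in [set t | (0 <= t)%R]]
    - ereal_inf [set (f t)%:E | t in [set t | (0 <= t)%R]] <= c%:E)%E <->
  (forall s t, 0 <= s -> 0 <= t -> f s - f t <= c).
Proof.
set A := [set (f t)%:E | t in _]; split=> [H s t s0 t0|H].
  rewrite -lee_fin EFinB; apply: le_trans H; apply: leeB.
    by apply: ereal_sup_ubound; exists s.
  by apply: ereal_inf_lbound; exists t.
have infle : (ereal_inf A <= (f 0)%:E)%E by apply: ereal_inf_lbound; exists 0 => /=.
have infge s : 0 <= s -> ((f s - c)%:E <= ereal_inf A)%E.
  move=> s0; apply: le_ereal_inf_tmp => _ [t t0 <-]; rewrite lee_fin.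
  by have := H s t s0 t0; lra.
(* The infimum lies between [f 0 - c] and [f 0]; being finite, it can be moved across the
   inequality. *)
have : ereal_inf A \is a fin_num.
  rewrite fin_numE; apply/andP; split; apply/eqP => E.
    by have := infge 0 (lexx _); rewrite E.
  by move: infle; rewrite E.
case: (ereal_inf A) infge infle => [r| |] // infge infle _.
rewrite leeBlDr// -EFinD; apply: ge_ereal_sup => _ [s s0 <-].
by have := infge s s0; rewrite !lee_fin; lra.
Qed.

(** A strict bound leaves room for some [1 / (m + 1)], which makes the condition a countable union
    of closed ones. *)
Lemma ereal_width_lt (R : realType) (f : R -> R) (c : R) :
  (ereal_sup [set (f t)%:E | t in [set t | (0 <= t)%R]]
    - ereal_inf [set (f t)%:E | t in [set t | (0 <= t)%R]] < c%:E)%E <->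
  (exists m : nat, forall s t, 0 <= s -> 0 <= t -> f s - f t <= c - m.+1%:R^-1).
Proof.
split; last first.
  move=> [m /ereal_width_le H]; apply: le_lt_trans H _.
  by rewrite lte_fin ltrBlDr ltrDl invr_gt0.
set w := (X in (X < _)%E) => wc.
have [b wb bc] : exists2 b, (w <= b%:E)%E & b < c.
  case: w wc => [r| |] //; first by rewrite lte_fin => rc; exists r.
  by move=> _; exists (c - 1); rewrite ?leNye// ltrBlDr ltrDl.
have [|m mP] := @nat_inv_lt R (c - b); first by rewrite subr_gt0.
exists m => s t s0 t0; have := (ereal_width_le f b).1 wb s t s0 t0.
by move=> /le_trans; apply; rewrite lerBrDr -lerBrDl ltW.
Qed.

(** * Regularity of the flow and measurability of the width event *)

Section FlowMeasurability.
Variables (R : realType) (N : nat) (S I : R -> R) (omega : 'I_N -> R) (kappa : R).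
Variable theta : ('I_N -> R) -> R -> 'I_N -> R.
Hypotheses (Sp : periodic_2pi R S) (Ip : periodic_2pi R I).
Hypotheses (SL : lipschitz_fun R S) (IL : lipschitz_fun R I).
Hypothesis flow : is_flow R N S I omega kappa theta.

Lemma flow_box_continuous (t : R) (i : 'I_N) :
  0 <= t -> box_continuous (fun x => theta x t i).
Proof.
move=> t0 x e e0.
have [L L0 VL] := meanfield_lipschitz omega kappa Sp Ip SL IL.
pose C := expR (2 * L * N%:R * t) * N%:R.
have C0 : 0 <= C by rewrite mulr_ge0 ?expR_ge0.
have e2 : 0 < e ^+ 2 / (C + 1) by rewrite divr_gt0 ?exprn_gt0// ltr_wpDl.
(* Gronwall's bound concerns squares: the cap 1 gives [|x j - y j| ^+ 2 <= |x j - y j|], and the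
   other term makes the total less than [e ^+ 2]. *)
exists (Num.min 1 (e ^+ 2 / (C + 1))); first by rewrite lt_min ltr01.
move=> y xy.
have G := @gronwall_flow R N _ L (theta x) (theta y) t VL (flow x).2 (flow y).2 L0 t0.
rewrite -(@ltr_pXn2r _ 2) ?nnegrE ?(ltW e0) ?normr_ge0 // real_normK ?num_real//.
apply: le_lt_trans (_ : _ <= \sum_(i < N) (theta x t i - theta y t i) ^+ 2) _.
  by rewrite (bigD1 i)//= lerDl sumr_ge0// => j _; exact: sqr_ge0.
apply: le_lt_trans G _; rewrite (flow x).1 (flow y).1.
apply: le_lt_trans (_ : _ <= C * (e ^+ 2 / (C + 1))) _.
  rewrite -[leRHS]mulrA; apply: ler_wpM2l; first exact: expR_ge0.
  apply: le_trans (_ : _ <= \sum_(i < N) e ^+ 2 / (C + 1)) _; last first.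
    by rewrite sumr_const card_ord mulr_natl.
  apply: ler_sum => j _; have := xy j; rewrite lt_min => /andP[h1 h2].
  rewrite -real_normK ?num_real// expr2; apply: ltW; apply: le_lt_trans h2.
  by rewrite ler_piMr// ltW.
rewrite mulrA ltr_pdivrMr ?ltr_wpDl// mulrDr mulr1 [C * _]mulrC ltrDl.
by rewrite exprn_gt0.
Qed.

Lemma order_param_box_continuous (t : R) :
  0 <= t -> box_continuous (fun x => order_param R N I (theta x t)).
Proof.
move=> t0.
have cI j := box_continuous_comp (lipschitz_continuous IL) (@flow_box_continuous t j t0).
have := box_continuous_comp (@mulrl_continuous R N%:R^-1) (box_continuous_sum cI).
exact.
Qed.

Lemma flow_continuous x i : continuous (fun t => theta x t i).
Proof. exact: is_derive1_continuous (fun t => (flow x).2 t i). Qed.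

Lemma order_param_continuous x : continuous (fun t => order_param R N I (theta x t)).
Proof.
move=> t; apply: cvgM; first exact: cvg_cst.
apply: (@cvg_big _ _ _ _ _ _ _ _ _ (fun j t => I (theta x t j))) => [|j _].
  exact: add_continuous.
apply: (@continuous_comp _ _ _ (fun t => theta x t j) I).
  exact: flow_continuous.
exact: lipschitz_continuous.
Qed.

Lemma measurable_width_lt (c : R) (i : 'I_N) :
  measurable ([set x | (ereal_sup [set (theta x t i)%:E | t in [set t | (0 <= t)%R]]
    - ereal_inf [set (theta x t i)%:E | t in [set t | (0 <= t)%R]] < c%:E)%E]
    : set (RN R N)).
Proof.
(* Absolute values turn rationals into nonnegative times; the negation brings the upper bound into
   the form of a superlevel set. *)
rewrite (_ : [set x | _] = \bigcup_(m : nat) \bigcap_(q : rat * rat)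
    [set x | - (c - m.+1%:R^-1) <= - (theta x `|ratr q.1| i + - theta x `|ratr q.2| i)]).
  apply: bigcupT_measurable => m; apply: bigcap_countType_measurable => q.
  apply: box_continuous_ge_measurable; apply: box_continuousN.
  apply: box_continuousD; last apply: box_continuousN; exact: flow_box_continuous.
have abs_cont x : continuous (fun u : R => theta x `|u| i).
  move=> u; apply: (@continuous_comp _ _ _ (fun u : R => `|u|) (fun u => theta x u i)).
    exact: norm_continuous.
  exact: flow_continuous.
rewrite eqEsubset; split=> x /=.
  by move=> /(ereal_width_lt (fun t => theta x t i))[m H]; exists m => // q _ /=; rewrite lerN2 H.
move=> [m _ H]; apply/(ereal_width_lt (fun t => theta x t i)); exists m.
move=> s t s0 t0.
(* Rational times are replaced by real ones in one variable, then in the other. *)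
have H1 q : theta x s i - theta x `|ratr q| i <= c - m.+1%:R^-1.
  rewrite -lerN2 -[s](ger0_norm s0).
  have cs : continuous (fun u : R => - (theta x `|u| i - theta x `|ratr q| i)).
    by move=> u; apply: cvgN; apply: cvgB; [exact: abs_cont|exact: cvg_cst].
  by apply: (ge_on_rationals cs) => p; exact: (H (p, q)).
rewrite -lerN2 -[t](ger0_norm t0).
have ct : continuous (fun u : R => - (theta x s i - theta x `|u| i)).
  by move=> u; apply: cvgN; apply: cvgB; [exact: cvg_cst|exact: abs_cont].
by apply: (ge_on_rationals ct) => q; rewrite lerN2.
Qed.

End FlowMeasurability.

(** * Persistence of the order parameter *)

(** Here [rho] stands for the order parameter, bounded below by [rho0], and [c * D] for a guaranteed
    inward strength of [S]: the coupling then outweighs the frequency [w]. *)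
Lemma drift_lt0 (R : realType) (w k rho0 rho c D s : R) :
  0 < k -> 0 < rho0 <= rho -> 0 <= c * D -> `|w| < k * rho0 * c * D ->
  s <= - (c * D) -> w + k * rho * s < 0.
Proof.
move=> k0 /andP[r0 r1] cD wlt sle.
have h1 : k * rho * s <= k * rho * - (c * D).
  by apply: ler_wpM2l => //; rewrite mulr_ge0 ?ltW// (lt_le_trans r0).
have h2 : k * rho0 * (c * D) <= k * rho * (c * D).
  by rewrite ler_wpM2r// ler_wpM2l// ltW.
by have := ler_norm w; lra.
Qed.

Lemma drift_gt0 (R : realType) (w k rho0 rho c D s : R) :
  0 < k -> 0 < rho0 <= rho -> 0 <= c * D -> `|w| < k * rho0 * c * D ->
  c * D <= s -> 0 < w + k * rho * s.
Proof.
move=> k0 r01 cD; rewrite -normrN -lerN2 => wlt sle.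
by have := drift_lt0 k0 r01 cD wlt sle; lra.
Qed.

Lemma max_norm_ge0 (R : realType) (N : nat) (omega : 'I_N -> R) :
  0 <= max_norm R N omega.
Proof. exact: bigmax_ge_id. Qed.

Lemma le_max_norm (R : realType) (N : nat) (omega : 'I_N -> R) i :
  `|omega i| <= max_norm R N omega.
Proof. exact: le_bigmax. Qed.

Section Confinement.
Variables (R : realType) (S I : R -> R) (alpha0 p q c1 c2 c3 : R) (N : nat).
Variables (omega : 'I_N -> R) (kappa Rstar : R).
Variable theta : ('I_N -> R) -> R -> 'I_N -> R.
Hypotheses (Sp : periodic_2pi R S) (Ip : periodic_2pi R I).
Hypothesis IL : lipschitz_fun R I.
Hypothesis alpha0_itv : 0 < alpha0 < pi.
Hypotheses (p1 : 1 <= p) (q1 : 1 <= q) (c10 : 0 < c1) (c20 : 0 < c2).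
Hypothesis c3_itv : 0 < c3 <= 1.
Hypothesis S_right :
  forall th, alpha0 <= th <= pi -> S th <= - (c1 * (pi - th) `^ p).
Hypothesis S_left :
  forall th, - pi <= th <= - alpha0 -> c1 * (th + pi) `^ p <= S th.
Hypothesis I_bounds :
  forall th, - pi <= th <= pi -> 0 <= I th <= c2 * (pi - `|th|) `^ q.
Hypothesis I_core : forall th, - pi <= th <= pi ->
  forall phi, `|phi| <= Num.max `|th| alpha0 -> c3 * I th <= I phi.
Hypothesis N0 : (0 < N)%N.
Hypothesis flow : is_flow R N S I omega kappa theta.
Hypothesis Rstar0 : 0 < Rstar.
Hypothesis kappa_large : Num.max
    (4 * (4 * c2) `^ (p / q) / (c1 * c3) * (max_norm R N omega / Rstar `^ (1 + p / q)))
    (4 / (c1 * c3 * (pi - alpha0) `^ p) * (max_norm R N omega / Rstar)) < kappa.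

Let r := c3 * Rstar / 4.
(** At distance [d] from pi, within the range where the bounds on [S] hold, a coupling with order
    parameter at least [r] beats every natural frequency. *)
Let strong d := max_norm R N omega < kappa * r * c1 * d `^ p.

Let c30 : 0 < c3. Proof. by case/andP: c3_itv. Qed.

Lemma circle_weight_ge0 x : 0 <= I x.
Proof.
have [m xm] := mod_2pi x; rewrite -(periodic_2pi_int m x Ip).
by case/andP: (I_bounds xm).
Qed.

Let alpha0_gap : 0 < pi - alpha0.
Proof. by rewrite subr_gt0; case/andP: alpha0_itv. Qed.

Lemma kappa_gt0 : 0 < kappa.
Proof.
apply: le_lt_trans kappa_large; rewrite le_max; apply/orP; right.
rewrite mulr_ge0// divr_ge0 ?max_norm_ge0 ?ltW// mulr_gt0 ?powR_gt0//.
exact: mulr_gt0.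
Qed.

Let r0 : 0 < r. Proof. by rewrite divr_gt0// mulr_gt0. Qed.

Let G0 : 0 < kappa * r * c1.
Proof. by rewrite !mulr_gt0 ?kappa_gt0. Qed.

(** A rearrangement of the second lower bound on [kappa]. *)
Lemma strong_gap : strong (pi - alpha0).
Proof.
have X0 := powR_gt0 p alpha0_gap; rewrite /strong.
have : 4 / (c1 * c3 * (pi - alpha0) `^ p) * (max_norm R N omega / Rstar) < kappa.
  by apply: le_lt_trans kappa_large; rewrite le_max lexx orbT.
move: (max_norm R N omega) ((pi - alpha0) `^ p) X0 => W X X0.
have -> : 4 / (c1 * c3 * X) * (W / Rstar) = W / (r * c1 * X).
  by rewrite /r; field; rewrite !gt_eqF.
by rewrite ltr_pdivrMr ?mulr_gt0// !mulrA.
Qed.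

Lemma strong_weight x :
  - pi <= x <= pi -> Rstar / 4 < I x -> strong (pi - `|x|).
Proof.
move=> xpi Ix; have /andP[_ Ile] := I_bounds xpi.
have q0 : 0 < q := lt_le_trans ltr01 q1.
have p0 : 0 < p := lt_le_trans ltr01 p1.
have d0 : 0 <= pi - `|x| by rewrite subr_ge0 ler_norml.
set d := pi - `|x| in d0 Ile *.
have c40 : 0 < 4 * c2 by rewrite mulr_gt0.
have dq : Rstar / (4 * c2) < d `^ q.
  rewrite ltr_pdivrMr//; have := lt_le_trans Ix Ile; rewrite ltr_pdivrMr//.
  by have -> : c2 * d `^ q * 4 = d `^ q * (4 * c2) by ring.
have Rc0 : 0 < Rstar / (4 * c2) by rewrite divr_gt0.
have dp : (Rstar / (4 * c2)) `^ (p / q) < d `^ p.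
  have -> : d `^ p = (d `^ q) `^ (p / q).
    by rewrite -powRrM; congr (_ `^ _); field; rewrite gt_eqF.
  by apply: gt0_ltr_powR; rewrite ?nnegrE ?powR_ge0 ?divr_gt0// ltW.
(* With this factorisation the real powers can be generalised to variables, leaving a rational
   identity. *)
have ZY : (Rstar / (4 * c2)) `^ (p / q) * (4 * c2) `^ (p / q) = Rstar `^ (p / q).
  rewrite -powRM ?ltW//; congr (_ `^ _); rewrite divfK//; exact: lt0r_neq0.
apply: le_lt_trans (_ : kappa * r * c1 * (Rstar / (4 * c2)) `^ (p / q) < _); last first.
  by rewrite ltr_pM2l.
have Y0 := powR_gt0 (p / q) c40; have Q0 := powR_gt0 (p / q) Rc0.
have := le_lt_trans _ kappa_large.
move=> /(_ (4 * (4 * c2) `^ (p / q) / (c1 * c3) * (max_norm R N omega / Rstar `^ (1 + p / q)))).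
rewrite le_max lexx => /(_ isT).
have RE : Rstar `^ (1 + p / q) = Rstar * Rstar `^ (p / q).
  by rewrite powRD ?(lt0r_neq0 Rstar0) ?implybT// powRr1// ltW.
rewrite RE -ZY.
move: (max_norm R N omega) (_ `^ (p / q)) Y0 (_ `^ (p / q)) Q0 => W Y Y0 Q Q0.
have -> : 4 * Y / (c1 * c3) * (W / (Rstar * (Q * Y))) = W / (r * c1 * Q).
  by rewrite /r; field; rewrite !gt_eqF.
by rewrite ltr_pdivrMr ?mulr_gt0// !mulrA => /ltW.
Qed.

Let drift x (t : R) i :
  is_derive t 1 (fun s => theta x s i)
    (omega i + kappa * order_param R N I (theta x t) * S (theta x t i)).
Proof.
refine (is_derive_eq ((flow x).2 t i) _); congr (_ + _ * _).
by rewrite /order_param mulrA.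
Qed.

(** Stated through values of [S] rather than positions, so that periodicity transfers it to every
    odd multiple of pi. *)
Let inward x t i d : 0 <= d <= pi - alpha0 -> strong d ->
  r <= order_param R N I (theta x t) ->
  (S (theta x t i) = S (pi - d) ->
    omega i + kappa * order_param R N I (theta x t) * S (theta x t i) < 0) /\
  (S (theta x t i) = S (- pi + d) ->
    0 < omega i + kappa * order_param R N I (theta x t) * S (theta x t i)).
Proof.
move=> /andP[d0 da] ds rle.
have a0 : 0 < alpha0 by case/andP: alpha0_itv.
have ws : `|omega i| < kappa * r * c1 * d `^ p := le_lt_trans (le_max_norm omega i) ds.
have cD : 0 <= c1 * d `^ p by rewrite mulr_ge0 ?powR_ge0// ltW.
split=> ->.
  apply: (drift_lt0 kappa_gt0 _ cD ws); first by rewrite r0.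
  rewrite -[in leRHS](subKr pi d); apply: S_right.
  by apply/andP; split; lra.
apply: (drift_gt0 kappa_gt0 _ cD ws); first by rewrite r0.
rewrite [in leLHS](_ : d = - pi + d + pi); last by ring.
apply: S_left.
by apply/andP; split; lra.
Qed.

(** Bootstrap at the first time [tau] when the level [r] is reached: the barriers hold before [tau],
    so [keep] holds at [tau] and contradicts equality there. *)
Lemma order_param_confined x : (forall i, - pi <= x i <= pi) ->
  Rstar / 2 < order_param R N I x ->
  forall t, 0 <= t -> r < order_param R N I (theta x t).
Proof.
move=> xpi x2 t1 t10; rewrite ltNge; apply/negP => ft1.
have /andP[_ c31] := c3_itv.
have F0 : r < order_param R N I (theta x 0).
  rewrite (flow x).1; apply: le_lt_trans x2; rewrite /r.
  have h1 : c3 * Rstar <= 1 * Rstar by apply: ler_wpM2r => //; exact: ltW.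
  have h2 := ltW Rstar0; lra.
have [tau [tau0 _ Ftau before]] :=
  first_crossing (@order_param_continuous _ _ _ _ _ _ _ IL flow x) t10 F0 ft1.
have keep j : c3 * I (x j) - c3 * (Rstar / 4) <= I (theta x tau j).
  (* Oscillators of small initial weight need no control: their lower bound is nonpositive. *)
  have [small|big] := leP (I (x j)) (Rstar / 4).
    apply: le_trans (circle_weight_ge0 _).
    by rewrite -mulrBr; apply: mulr_ge0_le0; [exact: ltW|rewrite subr_le0].
  apply: le_trans (_ : c3 * I (x j) <= _).
    by rewrite gerBl mulr_ge0 ?divr_ge0 ?ltW.
  apply: (I_core (xpi j)); set b := Num.max _ _.
  have sb : strong (pi - b).
    rewrite /b; case: leP => _; first exact: strong_gap.
    exact: strong_weight.
  have bb : 0 <= pi - b <= pi - alpha0.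
    have /andP[_ api] := alpha0_itv.
    rewrite subr_ge0 lerD2l lerN2 /b ge_max le_max lexx orbT andbT ler_norml xpi.
    exact: ltW.
  apply: (barrier_confine (fun t => drift x t j) (T := tau)); last by rewrite tau0 lexx.
  - by rewrite (flow x).1 /b le_max lexx.
  - move=> t /before/ltW rt thb; apply: (inward _ bb sb rt).1.
    by rewrite thb subKr.
  - move=> t /before/ltW rt thb; apply: (inward _ bb sb rt).2.
    by rewrite thb addrA addNr add0r.
have : r < order_param R N I (theta x tau).
  have Nn : 0 < N%:R^-1 :> R by rewrite invr_gt0 ltr0n.
  (* The mean of the lower bounds exceeds [c3 * (Rstar / 2) - c3 * (Rstar / 4) = r]. *)
  apply: lt_le_trans (_ : N%:R^-1 * \sum_(j < N) (c3 * I (x j) - c3 * (Rstar / 4)) <= _).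
    rewrite big_split /= -mulr_sumr sumr_const card_ord -[X in _ + X]mulr_natl mulrDr.
    rewrite mulKf ?gt_eqF ?ltr0n// [X in X + _]mulrCA -/(order_param R N I x) /r.
    have : c3 * (Rstar / 2) < c3 * order_param R N I x by rewrite ltr_pM2l.
    lra.
  by rewrite /order_param ler_pM2l//; apply: ler_sum => j _; exact: keep.
by rewrite Ftau ltxx.
Qed.

(** [strong_gap] is strict and [strong] is monotone in the distance, so strength persists slightly
    below [pi - alpha0]: [d1]^ p[is the midpoint]m[between the threshold]w[and]A [^ p]. *)
Lemma trapping_width : exists d1 d2, [/\ 0 < d1, d1 < d2, d2 < pi - alpha0 &
  forall d, d1 <= d -> strong d].
Proof.
have p0 : 0 < p := lt_le_trans ltr01 p1.
have sg := strong_gap; rewrite /strong in sg.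
set A := pi - alpha0 in sg *; set W := max_norm R N omega in sg *.
have A0 : 0 < A := alpha0_gap.
have W0 : 0 <= W := max_norm_ge0 omega.
have H1 : W / (kappa * r * c1) < A `^ p by rewrite ltr_pdivrMr// mulrC.
have H2 : 0 <= W / (kappa * r * c1) by rewrite divr_ge0// ltW.
set w := W / _ in H1 H2.
pose m := (w + A `^ p) / 2.
have Ap0 := powR_gt0 p A0.
have m0 : 0 < m by rewrite /m; lra.
have wm : w < m by rewrite /m; lra.
have mA : m < A `^ p by rewrite /m; lra.
pose d1 := m `^ p^-1.
have d1p : d1 `^ p = m by rewrite /d1 -powRrM mulVf ?gt_eqF// powRr1 ?ltW.
have d10 : 0 < d1 by rewrite powR_gt0.
have d1A : d1 < A.
  rewrite ltNge; apply/negP => Ad.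
  have := ge0_ler_powR (ltW p0) _ _ Ad; rewrite !nnegrE d1p => /(_ (ltW A0) (ltW d10)).
  by rewrite leNgt mA.
exists d1, ((d1 + A) / 2); split=> //; try by lra.
move=> d d1d; rewrite /strong -/W mulrC -ltr_pdivrMr// -/w.
apply: lt_le_trans wm _; rewrite -d1p; apply: ge0_ler_powR => //; rewrite ?nnegrE ?ltW//.
exact: lt_le_trans d1d.
Qed.

Lemma width_confined x : (forall i, - pi <= x i <= pi) ->
  (forall t, 0 <= t -> r < order_param R N I (theta x t)) ->
  forall i, exists2 c, c < 2 * pi &
    forall s t, 0 <= s -> 0 <= t -> theta x s i - theta x t i <= c.
Proof.
move=> xpi Rr i.
have [d1 [d2 [d10 d12 d2a ds]]] := trapping_width.
have /andP[a0 _] := alpha0_itv.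
apply: (@width_lt_2pi _ (fun t => theta x t i) _ d1 d2 _ _ (fun t => drift x t i)).
- by rewrite d10.
- by lra.
- move=> t d m t0 /andP[dd1 dd2].
  have d_itv : 0 <= d <= pi - alpha0 by apply/andP; split; lra.
  have [r1 r2] := inward i d_itv (ds d dd1) (ltW (Rr t t0)).
  split=> E; [apply: r1|apply: r2]; rewrite E.
    by rewrite -[RHS](periodic_2pi_int m _ Sp); congr S; ring.
  (* The shift is [m + 1] here because the right side of the odd multiple corresponds to [- pi + d],
     not to [pi + d]. *)
  by rewrite -[RHS](periodic_2pi_int (m + 1) _ Sp) intrD; congr S; ring.
- by rewrite (flow x).1 ler_norml.
Qed.

End Confinement.

(** * Hoeffding's inequality *)

(* Hoeffding's inequality for a Bernoulli(u) variable: with D the Laplace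
   transform below, the logarithmic derivative of [expR (u s - s^2/8) * D s] is
   [u - s/4 - w s] where w = u e^(-s) / D solves w' = - w (1 - w) >= -1/4. *)
Lemma bernoulli_laplace_le (R : realType) (u s : R) :
  0 <= u <= 1 -> 0 <= s ->
  1 - u + u * expR (- s) <= expR (- (u * s) + s ^+ 2 / 8).
Proof.
move=> /andP[u0 u1] s0.
pose e (t : R) := expR (- t).
pose D t := 1 - u + u * e t.
have e0 t : 0 < e t by exact: expR_gt0.
have D0 t : 0 < D t.
  have [u00|un0] := eqVneq u 0; first by rewrite /D u00 mul0r subr0 addr0.
  have : 0 < u * e t by rewrite mulr_gt0// lt_neqAle eq_sym un0.
  by rewrite /D; lra.
have eE (t : R) : is_derive t 1 e (- e t).
  have := @is_derive1_comp _ expR -%R t _ _ (is_derive_expR _) (is_deriveN (is_derive_id t 1)).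
  by rewrite mulrN1.
have DE (t : R) : is_derive t 1 D (- (u * e t)).
  have h := is_deriveD (is_derive_cst (1 - u) t 1) (is_deriveZ u (eE t)).
  by refine (is_derive_eq h _); rewrite add0r /GRing.scale /= mulrN.
pose w t := u * e t / D t.
have wE (t : R) : is_derive t 1 w (- w t + w t ^+ 2).
  have Dn : D t != 0 by rewrite gt_eqF.
  have h := is_deriveM (is_deriveZ u (eE t)) (is_deriveV Dn (DE t)).
  refine (is_derive_eq h _); rewrite /w /GRing.scale /=.
  by rewrite [X in X * _ + _](_ : _ = u * e t) //; field.
pose L (t : R) := u - 4^-1 * t - w t.
have L_le0 t : 0 <= t -> L t <= 0.
  move=> t0.
  have LE (x : R) : is_derive x 1 L (- 4^-1 - (- w x + w x ^+ 2)).
    have h1 := is_deriveB (is_derive_cst u x 1) (is_deriveZ (4^-1 : R) (is_derive_id x 1)).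
    refine (is_derive_eq (is_deriveB h1 (wE x)) _).
    by rewrite /GRing.scale /= mulr1 add0r.
  have <- : L 0 = 0.
    by rewrite /L /w /D /e oppr0 expR0 mulr0 subr0 !mulr1 subrK divr1 subrr.
  (* The derivative of [L] equals [- (w x - 1 / 2) ^+ 2]. *)
  apply: (is_derive_le0_nonincr LE t0) => x _.
  by have := sqr_ge0 (w x - 2^-1); rewrite !expr2; lra.
pose E (t : R) := expR (u * t - 8^-1 * t ^+ 2).
have EE (t : R) : is_derive t 1 E (E t * (u - 4^-1 * t)).
  have h1 := is_deriveB (is_deriveZ u (is_derive_id t 1))
    (is_deriveZ (8^-1 : R) (is_deriveX 2 (is_derive_id t 1))).
  refine (is_derive_eq (is_derive1_comp (is_derive_expR _) h1) _).
  congr (_ * _); rewrite /GRing.scale /= expr1; by field.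
have GE (t : R) : is_derive t 1 (E * D) (E t * D t * L t).
  refine (is_derive_eq (is_deriveM (EE t) (DE t)) _).
  rewrite /L /w /GRing.scale /=; have := lt0r_neq0 (D0 t); move: (D t) => d d0.
  by field.
have : E s * D s <= E 0 * D 0.
  apply: (is_derive_le0_nonincr GE s0) => t /andP[t0 _].
  by rewrite mulr_ge0_le0 ?L_le0// mulr_ge0 ?expR_ge0 ?ltW.
rewrite /E /D /e oppr0 mulr0 expr0n /= mulr0 subrr expR0 mulr1 subrK mulr1.
have -> : - (u * s) + s ^+ 2 / 8 = - (u * s - 8^-1 * s ^+ 2) by ring.
by move=> H; rewrite [in leRHS]expRN -[leRHS]mulr1 ler_pdivlMl ?expR_gt0.
Qed.

(* The tangent of expR at [- (a * s)], evaluated at [0] and [- s]. *)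
Lemma expR_chord (R : realType) (a s : R) :
  0 <= a <= 1 -> expR (- (a * s)) <= 1 - a + a * expR (- s).
Proof.
move=> /andP[a0 a1]; set y := - (a * s).
have tangent z : expR y * (1 + (z - y)) <= expR z.
  rewrite -[in leRHS](subrKC y z) expRD; apply: ler_wpM2l; first exact: expR_ge0.
  exact: expR_ge1Dx.
have h0 : (1 - a) * (expR y * (1 + (0 - y))) <= (1 - a) * expR 0.
  by apply: ler_wpM2l => //; rewrite subr_ge0.
have h1 : a * (expR y * (1 + (- s - y))) <= a * expR (- s) by apply: ler_wpM2l.
rewrite expR0 in h0.
have E : (1 - a) * (expR y * (1 + (0 - y))) + a * (expR y * (1 + (- s - y)))
    = expR y * (1 - y - a * s) by ring.
have : expR y * (1 - y - a * s) = expR y.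
  by rewrite /y opprK addrK mulr1.
by lra.
Qed.

(** By convexity each value in [[0, M]] is replaced by a variable on the two points 0 and [M] with
    the same mean; the Bernoulli bound then applies with [u] the mean over [M] and [s = lam * M]. *)
Lemma finite_laplace_le (R : realType) (n : nat) (p v : 'I_n -> R) (M lam : R) :
  0 < M -> 0 <= lam -> (forall k, 0 <= p k) -> \sum_(k < n) p k = 1 ->
  (forall k, p k != 0 -> 0 <= v k <= M) ->
  \sum_(k < n) p k * expR (- (lam * v k)) <=
    expR (- (lam * \sum_(k < n) p k * v k) + lam ^+ 2 * M ^+ 2 / 8).
Proof.
move=> M0 lam0 p0 p1 vM; have Mn : M != 0 by rewrite gt_eqF.
pose u := (\sum_(k < n) p k * v k) / M.
have pv0 k : 0 <= p k * v k <= p k * M.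
  have [->|pk] := eqVneq (p k) 0; first by rewrite !mul0r lexx.
  by have /andP[v0 vm] := vM k pk; rewrite mulr_ge0//= ler_wpM2l.
have u01 : 0 <= u <= 1.
  apply/andP; split.
    by rewrite divr_ge0 ?(ltW M0)// sumr_ge0// => k _; case/andP: (pv0 k).
  rewrite ler_pdivrMr// -p1 mulr_suml; apply: ler_sum => k _.
  by case/andP: (pv0 k).
have s0 : 0 <= lam * M by rewrite mulr_ge0// ltW.
have := bernoulli_laplace_le u01 s0.
have -> : u * (lam * M) = lam * \sum_(k < n) p k * v k.
  by rewrite mulrCA /u divfK.
rewrite exprMn; apply: le_trans.
have -> : 1 - u + u * expR (- (lam * M)) =
    \sum_(k < n) p k * (1 - v k / M + v k / M * expR (- (lam * M))).
  under eq_bigr => k _.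
    rewrite (_ : _ * _ = p k + p k * v k * ((expR (- (lam * M)) - 1) / M)); last by field.
    over.
  by rewrite big_split /= p1 -mulr_suml /u; field.
apply: ler_sum => k _; have [->|pk] := eqVneq (p k) 0; first by rewrite !mul0r.
apply: ler_wpM2l => //; have /andP[v0 vm] := vM k pk.
have := @expR_chord R (v k / M) (lam * M).
rewrite (_ : v k / M * (lam * M) = lam * v k); last by field.
by apply; rewrite divr_ge0 ?(ltW M0)//= ler_pdivrMr// mul1r.
Qed.

Lemma le_measure_bigsetU (d : measure_display) (T : measurableType d) (R : realType)
    (P : {measure set T -> \bar R}) (J : Type) (s : seq J) (Q : pred J) (B : J -> set T) :
  (forall j, measurable (B j)) ->
  (P (\big[setU/set0]_(j <- s | Q j) B j) <= \sum_(j <- s | Q j) P (B j))%E.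
Proof.
move=> mB; elim: s => [|j s IH]; first by rewrite !big_nil measure0.
rewrite !big_cons; case: ifP => // _.
apply: le_trans (measureU2 _ _ _) _; rewrite ?leeD2l//.
exact: bigsetU_measurable.
Qed.

(** * Lower tail of an empirical mean under the product measure *)

Section MeanTail.
Variables (R : realType) (N : nat) (mu : probability R R) (P : probability (RN R N) R).
Hypothesis muP : is_product_measure R N mu P.
Variables (f : R -> R) (D : set R) (M m : R).
Hypotheses (mD : measurable D) (mf : measurable_fun setT f) (D1 : mu D = 1%E).
Hypotheses (M0 : 0 < M) (f_itv : forall x, D x -> 0 <= f x <= M).
Hypothesis f_mean : (\int[mu]_(x in D) (f x)%:E = m%:E)%E.

Section Levels.
Variable n : nat.
Let h := M / n.+1%:R.
Let v (k : 'I_n.+2) : R := k%:R * h.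
(** Half-open level sets of [f] of height [h]; the last index [n + 1] is there for the value [M]
    itself. *)
Let A (k : 'I_n.+2) : set R := D `&` [set x | v k <= f x < v k + h].
Let p k := fine (mu (A k)).

Let h0 : 0 < h. Proof. by rewrite divr_gt0. Qed.

Let mA k : measurable (A k).
Proof.
rewrite /A (_ : [set x | _] = f @^-1` `[v k, v k + h[); last first.
  by apply/seteqP; split => x /=; rewrite in_itv.
by apply: measurableI => //; rewrite -[X in measurable X]setTI; exact: mf.
Qed.

Let pE k : mu (A k) = (p k)%:E.
Proof. by rewrite fineK// fin_num_measure. Qed.

Let p0 k : 0 <= p k.
Proof. exact: fine_ge0. Qed.

Let A_triv (X : set 'I_n.+2) : trivIset X A.
Proof.
have le_lev (i j : 'I_n.+2) x : A i x -> A j x -> (i <= j)%N.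
  move=> [_ /andP[ix _]] [_ /andP[_ jx]].
  have := le_lt_trans ix jx; rewrite /v -{3}[h]mul1r -mulrDl ltr_pM2r//.
  by rewrite natr1 ltr_nat ltnS.
move=> i j _ _ [x [ix jx]]; apply/val_inj/eqP.
by rewrite eqn_leq (le_lev i j x)// (le_lev j i x).
Qed.

Let A_cover x : D x -> exists k, A k x.
Proof.
move=> Dx; have /andP[f0 fM] := f_itv Dx.
have fh0 : 0 <= f x / h by rewrite divr_ge0// ltW.
have := truncn_itv fh0; move: (Num.trunc (f x / h)) => k /andP[t1 t2].
have kn : (k < n.+2)%N.
  rewrite ltnS -(@ler_nat R); apply: le_trans t1 _.
  by rewrite ler_pdivrMr// /h mulrC divfK.
exists (Ordinal kn); split=> //=; rewrite /v /= -{3}[h]mul1r -mulrDl natr1.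
by rewrite -ler_pdivlMr// t1 -ltr_pdivrMr.
Qed.

Let A_union : \big[setU/set0]_(k <- index_enum 'I_n.+2) A k = D.
Proof.
rewrite -bigcup_seq; apply/seteqP; split => [x [k _ []]//|x /A_cover[k kx]].
by exists k => //=; rewrite mem_index_enum.
Qed.

Let p_sum : \sum_(k < n.+2) p k = 1.
Proof.
have : mu D = (\sum_(k < n.+2) mu (A k))%E.
  rewrite -{1}A_union; apply: measure_semi_additive_ord.
  - exact: mA.
  - exact: A_triv.
  - by rewrite A_union.
by rewrite D1; under eq_bigr do rewrite pE; rewrite sumEFin => -[].
Qed.

(** On level [k], [f] is below [v k + h], so rounding down lowers the mean by at most [h]. *)
Let p_mean : m - h <= \sum_(k < n.+2) p k * v k.
Proof.
rewrite lerBlDr -lee_fin -f_mean -A_union.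
rewrite ge0_integral_bigsetU ?index_enum_uniq//; last 2 first.
- rewrite A_union; apply/measurable_EFinP; exact: measurable_funS mf.
- by rewrite A_union => x /f_itv/andP[]; rewrite lee_fin.
apply: le_trans (_ : (\sum_(k < n.+2) (p k * (v k + h))%:E <= _)%E); last first.
  under eq_bigr do rewrite mulrDr EFinD.
  by rewrite big_split /= !sumEFin -mulr_suml p_sum mul1r EFinD.
apply: lee_sum => k _.
apply: le_trans (_ : (\int[mu]_(x in A k) cst (v k + h)%:E x <= _)%E); last first.
  by rewrite integral_cst// mulrC EFinM -pE; exact: lexx.
apply: ge0_le_integral => //.
- by move=> x [/f_itv/andP[]]; rewrite lee_fin.
- by apply/measurable_EFinP; exact: measurable_funS mf.
- by move=> x [_ /andP[_ /ltW]]; rewrite lee_fin.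
Qed.

(* Chernoff's bound, computed on the finitely many level boxes covering the
   event, so that no integral against P is needed. *)
Lemma mean_tail_cover (a lam : R) : 0 <= lam ->
  exists C : set (RN R N), [/\ measurable C,
    (forall x, (forall i, D (x i)) -> \sum_(i < N) f (x i) <= a -> C x) &
    (P C <= (expR (lam * a + N%:R *
       (- (lam * (m - h)) + lam ^+ 2 * M ^+ 2 / 8)))%:E)%E].
Proof.
move=> lam0.
pose B (g : {ffun 'I_N -> 'I_n.+2}) : set (RN R N) := [set x | forall i, A (g i) (x i)].
pose low (g : {ffun 'I_N -> 'I_n.+2}) := \sum_(i < N) v (g i) <= a.
have mB g : measurable (B g) by apply: (@box_measurable R N (fun i => A (g i))).
(* One box per assignment of levels whose rounded-down values sum to at most [a]; rounding down
   keeps the event inside the union. *)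
exists (\big[setU/set0]_(g <- index_enum {ffun 'I_N -> 'I_n.+2} | low g) B g); split.
- exact: bigsetU_measurable.
- move=> x Dx xa; have /choice[g gx] : forall i, exists k, A k (x i).
    by move=> i; apply: A_cover.
  rewrite -bigcup_seq_cond; exists [ffun i => g i]; last by move=> i; rewrite ffunE.
  rewrite /= mem_index_enum /=; apply: le_trans xa; apply: ler_sum => i _.
  by rewrite ffunE; case: (gx i) => _ /andP[].
apply: le_trans (le_measure_bigsetU _ _ _ mB) _.
rewrite (eq_bigr (fun g : {ffun _} => (\prod_(i < N) p (g i))%:E)); last first.
  by move=> g _; exact: muP.
rewrite sumEFin lee_fin.
(* On [low] assignments the factor [expR (lam * (a - sum))] is at least 1; the remaining assignments
   only add nonnegative terms. *)
apply: le_trans (_ : \sum_(g : {ffun 'I_N -> 'I_n.+2})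
    expR (lam * a) * \prod_(i < N) (p (g i) * expR (- (lam * v (g i)))) <= _).
  rewrite [leRHS](bigID low) /=; apply: ler_wpDr.
    apply: sumr_ge0 => g _; rewrite mulr_ge0 ?expR_ge0//.
    by apply: prodr_ge0 => i _; rewrite mulr_ge0 ?expR_ge0.
  apply: ler_sum => g lg; rewrite big_split /= mulrCA -[leLHS]mulr1.
  apply: ler_wpM2l; first exact: prodr_ge0.
  rewrite -expR_sum -expRD -expR0 ler_expR sumrN -mulr_sumr -mulrBr.
  by rewrite mulr_ge0// subr_ge0.
(* Independence: the sum over assignments factors into the [N]-th power of a single Laplace
   transform. *)
rewrite -mulr_sumr -(bigA_distr_bigA (fun i k => p k * expR (- (lam * v k)))) /=.
rewrite prodr_const card_ord expRD; apply: ler_wpM2l; first exact: expR_ge0.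
rewrite mulrC expRM_natr lerXn2r ?nnegrE ?expR_ge0//.
  by apply: sumr_ge0 => k _; rewrite mulr_ge0 ?expR_ge0.
have vM k : p k != 0 -> 0 <= v k <= M.
  move=> pk; have [x [Dx /andP[vx _]]] : A k !=set0.
    by apply/set0P/eqP => A0; move: pk; rewrite /p A0 measure0 eqxx.
  rewrite mulr_ge0 ?(ltW h0)//=; apply: le_trans vx _.
  by case/andP: (f_itv Dx).
apply: le_trans (finite_laplace_le M0 lam0 p0 p_sum vM) _.
by rewrite ler_expR lerD2r lerN2; apply: ler_wpM2l.
Qed.

End Levels.

Lemma mean_tail (E : set (RN R N)) : (0 < N)%N -> 0 < m -> measurable E ->
  (forall x, (forall i, D (x i)) -> m / 2 < N%:R^-1 * \sum_(i < N) f (x i) -> E x) ->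
  ((1 - expR (- (m ^+ 2 * N%:R) / (2 * M ^+ 2)))%:E <= P E)%E.
Proof.
move=> N0 m0 mE EP.
have Nr : 0 < N%:R :> R by rewrite ltr0n.
(* The minimiser of [- lam * m / 2 + lam ^+ 2 * M ^+ 2 / 8], giving the exponent [- X]; the
   discretisation costs [N * lam * h = K / (n + 1)]. *)
pose lam := 2 * m / M ^+ 2.
have lam0 : 0 <= lam by rewrite divr_ge0 ?mulr_ge0 ?exprn_ge0 ?ltW.
pose X := m ^+ 2 * N%:R / (2 * M ^+ 2).
pose K := N%:R * lam * M.
have K0 : 0 <= K by rewrite mulr_ge0 ?(ltW M0)// mulr_ge0.
have PE : P E = (fine (P E))%:E by rewrite fineK// fin_num_measure.
have step n : 1 - fine (P E) <= expR (- X + K / n.+1%:R).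
  have [C [mC CP]] := @mean_tail_cover n (N%:R * (m / 2)) lam lam0.
  have -> : lam * (N%:R * (m / 2)) + N%:R *
      (- (lam * (m - M / n.+1%:R)) + lam ^+ 2 * M ^+ 2 / 8) = - X + K / n.+1%:R.
    rewrite /X /K /lam; field.
    by rewrite nat1r pnatr_eq0 (gt_eqF M0).
  move: (expR (- X + _)) => b PC.
  (* The box with all coordinates in [D] has full measure and is covered by [E] and [C]. *)
  have le1 : (1 <= P (E `|` C))%E.
    have <- : P [set x | forall i, D (x i)] = 1%E.
      by rewrite (@muP (fun=> D) (fun=> mD)) big1// => i _; rewrite D1.
    apply: le_measure; rewrite ?inE.
    - exact: (@box_measurable R N (fun=> D)).
    - exact: measurableU.
    - move=> x Dx; have [xm|xm] := ltP (m / 2) (N%:R^-1 * \sum_(i < N) f (x i)).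
        by left; apply: EP.
      by right; apply: CP => //; rewrite -ler_pdivrMl.
  have : (1 <= P E + b%:E)%E.
    by apply: le_trans le1 (le_trans (measureU2 _ mE mC) _); exact: leeD2l.
  by rewrite PE -EFinD lee_fin lerBlDl.
(* Passage to the limit in [n], by contradiction: a strict failure leaves a positive gap between
   logarithms, which some [K / (n + 1)] fits under. *)
rewrite PE lee_fin mulNr -/X lerBlDr addrC -lerBlDr leNgt; apply/negP => lt.
have q0 : 0 < 1 - fine (P E) := lt_trans (expR_gt0 _) lt.
have lnX : - X < ln (1 - fine (P E)) by rewrite -(expRK (- X)) ltr_ln ?posrE ?expR_gt0.
have [|n nP] := @nat_inv_lt R ((ln (1 - fine (P E)) + X) / (K + 1)).
  by apply: divr_gt0; [rewrite addrC -ltrBlDl sub0r|exact: ltr_wpDl].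
have := step n; rewrite leNgt => /negP; apply.
rewrite -[ltRHS]lnK ?posrE// ltr_expR addrC -ltrBrDr opprK.
rewrite ltr_pdivlMr in nP; last exact: ltr_wpDl.
apply: le_lt_trans nP.
by rewrite mulrC ler_wpM2l ?invr_ge0// lerDl.
Qed.

End MeanTail.

(** * Measurability and probability of the confinement event *)

Lemma sup_norm_ub (R : realType) (I : R -> R) :
  (exists M, forall x, `|I x| <= M) -> forall x, `|I x| <= sup_norm R I.
Proof.
move=> [M IM] x; apply: ub_le_sup; last by exists x.
by exists M => _ [y _ <-].
Qed.

Unset Implicit Arguments.

Theorem theorem2p12 (R : realType) (S I : R -> R)
  (alpha0 p q c1 c2 c3 : R) (N : nat) (omega : 'I_N -> R) (kappa : R)
  (theta : ('I_N -> R) -> R -> 'I_N -> R)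
  (mu : probability R R) (P : probability (RN R N) R) (Rstar : R) :
  periodic_2pi R S -> periodic_2pi R I -> lipschitz_fun R S -> lipschitz_fun R I ->
  0 < alpha0 < pi -> 1 <= p -> 1 <= q -> 0 < c1 -> 0 < c2 -> 0 < c3 <= 1 ->
  (forall th, alpha0 <= th <= pi -> S th <= - (c1 * (pi - th) `^ p)) ->
  (forall th, - pi <= th <= - alpha0 -> c1 * (th + pi) `^ p <= S th) ->
  (forall th, - pi <= th <= pi -> 0 <= I th <= c2 * (pi - `|th|) `^ q) ->
  (forall th, - pi <= th <= pi ->
     forall phi, `|phi| <= Num.max `|th| alpha0 -> c3 * I th <= I phi) ->
  (0 < N)%N ->
  is_flow R N S I omega kappa theta ->
  mu [set x : R | - pi <= x <= pi] = 1%E ->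
  (\int[mu]_(x in [set x : R | (- pi <= x <= pi)%R]) (I x)%:E)%E = Rstar%:E ->
  0 < Rstar ->
  is_product_measure R N mu P ->
  Num.max
    (4 * (4 * c2) `^ (p / q) / (c1 * c3) * (max_norm R N omega / Rstar `^ (1 + p / q)))
    (4 / (c1 * c3 * (pi - alpha0) `^ p) * (max_norm R N omega / Rstar)) < kappa ->
  let E : set (RN R N) :=
    [set x0 | (forall i, - pi <= x0 i <= pi) /\
       (forall t, 0 <= t -> c3 * Rstar / 4 < order_param R N I (theta x0 t)) /\
       (forall i, (ereal_sup [set (theta x0 t i)%:E | t in [set t | (0 <= t)%R]]
                   - ereal_inf [set (theta x0 t i)%:E | t in [set t | (0 <= t)%R]]
                   < (2 * pi)%:E)%E)] in
  measurable E /\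
  (((1 - expR (- (Rstar ^+ 2 * N%:R) / (2 * sup_norm R I ^+ 2)))%:E <= P E)%E).
Proof.
move=> Sp Ip SL IL a0 p1 q1 c10 c20 c30 Sr Sl Ib Ic N0 fl D1 Imean R0 muP kl E.
have mD : measurable [set x : R | - pi <= x <= pi].
  rewrite (_ : [set x | _] = `[- pi, pi]%classic) //; exact: measurable_itv.
have mE : measurable E.
  rewrite (_ : E = [set x | forall i, - pi <= x i <= pi] `&`
    ([set x | forall t, 0 <= t -> c3 * Rstar / 4 < order_param R N I (theta x t)] `&`
    \bigcap_(i : 'I_N) [set x |
      (ereal_sup [set (theta x t i)%:E | t in [set t | (0 <= t)%R]]
       - ereal_inf [set (theta x t i)%:E | t in [set t | (0 <= t)%R]]
       < (2 * pi)%:E)%E])); last first.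
    apply/seteqP; split => x /=.
      by move=> [xpi [xR xw]]; split=> //; split=> // i _; exact: xw.
    by move=> [xpi [xR xw]]; split=> //; split=> // i; exact: xw.
  apply: measurableI; first exact: (@box_measurable R N (fun=> [set x | - pi <= x <= pi])).
  apply: measurableI.
    apply: (@measurable_forall_gt R N (fun x t => order_param R N I (theta x t))).
      by move=> t t0; exact: (order_param_box_continuous Sp Ip SL IL fl).
    by move=> x; exact: (@order_param_continuous _ _ _ _ _ _ _ IL fl x).
  apply: bigcap_countType_measurable => i.
  exact: (measurable_width_lt Sp Ip SL IL fl).
split=> //.
have I0 x : 0 <= I x := circle_weight_ge0 Ip Ib x.
have IM x : `|I x| <= sup_norm R I := sup_norm_ub (periodic_lipschitz_bounded Ip IL) x.
(* If the supremum were 0, [I] would vanish and so would its integral [Rstar]. *)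
have M0 : 0 < sup_norm R I.
  rewrite lt_neqAle (le_trans (normr_ge0 _) (IM 0)) andbT; apply/eqP => M0.
  move: Imean; rewrite integral0_eq => [[E0]|x _]; first by rewrite E0 ltxx in R0.
  by have := IM x; rewrite -M0 normr_le0 => /eqP ->.
(* It remains to show that initial data in the cube with order parameter above [Rstar / 2] belong to
   [E], which is the deterministic part. *)
apply: (mean_tail muP mD _ D1 M0 _ Imean) => //.
- by apply: continuous_measurable_fun; exact: lipschitz_continuous.
- by move=> x _; rewrite I0 (le_trans (ler_norm _) (IM x)).
move=> x xpi xR.
have xR' := order_param_confined Ip IL a0 p1 q1 c10 c20 c30 Sr Sl Ib Ic N0 fl R0 kl xpi xR.
split=> //; split=> // i.
have [c c2pi width] := width_confined Sp a0 p1 c10 c30 Sr Sl fl R0 kl xpi xR' i.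
apply: le_lt_trans (_ : (_ <= c%:E)%E) _; last by rewrite lte_fin.
exact/ereal_width_le.
Qed.
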